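(* Let $q,n\ge1$ and let $P_n(z)$ be a monic $q\times q$ complex matrix polynomial of degree $n$ (leading coefficient $I_q$). If there exists a $q\times q$ complex matrix polynomial $Q_{n-1}(z)$ of degree $n-1$ such that $$f_{2n}(z)=P_n(z^2)+zQ_{n-1}(z^2)$$ is a Hurwitz-type matrix polynomial (HTM polynomial), then $P_n$ is a Hurwitz matrix polynomial, i.e. every $z\in\mathbb{C}$ with $\det P_n(z)=0$ satisfies $\operatorname{Re}z<0$.
   Context: A matrix polynomial has degree $d$ if its coefficient of $z^d$ is nonzero and all higher coefficients vanish. A $q\times q$ matrix polynomial $f_{2n}(z)=\sum_{k=0}^{2n}A_kz^{2n-k}$ with $\det A_0\ne0$, written as $f_{2n}(z)=h(z^2)+z\,g(z^2)$ with matrix polynomials $h,g$, is an HTM polynomial if there are (Hermitian) positive definite $q\times q$ matrices $c_0,\dots,c_{n-1},d_0,\dots,d_{n-1}$ such that $g(z)h(z)^{-1}=\Psi_0(z)$ as rational matrix functions, where $\Psi_{n-1}(z)=(zc_{n-1}+d_{n-1}^{-1})^{-1}$ and $\Psi_k(z)=\big(zc_k+(d_k+\Psi_{k+1}(z))^{-1}\big)^{-1}$ for $0\le k\le n-2$. (For $f_{2n}$ in the claim, $h=P_n$ and $g=Q_{n-1}$.) *)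

(* Defs.v *)
From mathcomp Require Import all_boot all_order all_algebra.
From mathcomp Require Import fraction sesquilinear spectral.
From mathcomp Require Import reals complex.

Set Implicit Arguments.
Unset Strict Implicit.
Unset Printing Implicit Defensive.

Import Order.TTheory GRing.Theory Num.Theory.
Local Open Scope ring_scope.
Local Open Scope sesquilinear_scope.
Local Open Scope complex_scope.

Section HTM.
Variables (R : realType) (q : nat).

(* A q x q matrix polynomial is a matrix with polynomial entries, and a
   rational matrix function is a matrix over the fraction field of the
   polynomials. *)
Local Notation mxpol := 'M[{poly R[i]}]_q.
Local Notation ratmx := 'M[{fraction {poly R[i]}}]_q.

Definition mxcoef (A : mxpol) (k : nat) : 'M[R[i]]_q := map_mx (coefp k) A.

Definition has_mxdegree (A : mxpol) (d : nat) : Prop :=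
  mxcoef A d <> 0 /\ forall k, (d < k)%N -> mxcoef A k = 0.

Definition mxeval (A : mxpol) (z : R[i]) : 'M[R[i]]_q :=
  map_mx (horner_eval z) A.

Definition hurwitz_mxpol (A : mxpol) : Prop :=
  forall z : R[i], \det (mxeval A z) = 0 -> complex.Re z < 0.

(* The order of R[i] only compares numbers with the same imaginary part, so
   the inequality states that the quadratic form is real and positive. *)
Definition posdefmx (A : 'M[R[i]]_q) : Prop :=
  A \is hermsymmx /\
  forall u : 'cV[R[i]]_q, u != 0 -> 0 < (u ^t* *m A *m u) 0 0.

(* h (z ^ 2) + z g (z ^ 2) *)
Definition mxpol_of_parts (h g : mxpol) : mxpol :=
  map_mx (comp_poly 'X^2) h + 'X *: map_mx (comp_poly 'X^2) g.

Definition ratmx_of_mxpol (A : mxpol) : ratmx := map_mx (@tofrac _) A.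

Definition ratmx_of_const (A : 'M[R[i]]_q) : ratmx :=
  ratmx_of_mxpol (map_mx polyC A).

Definition ratz : {fraction {poly R[i]}} := tofrac 'X.

(* [Psi c d k m] is Psi_k for the fraction with last index n - 1 = k + m.
   When all c_j, d_j are positive definite, every matrix inverted here is
   invertible: at each real z > 0 it evaluates to a positive definite matrix. *)
Fixpoint Psi (c d : nat -> 'M[R[i]]_q) (k m : nat) : ratmx :=
  match m with
  | 0 => invmx (ratz *: ratmx_of_const (c k) + ratmx_of_const (invmx (d k)))
  | m'.+1 => invmx (ratz *: ratmx_of_const (c k)
                    + invmx (ratmx_of_const (d k) + Psi c d k.+1 m'))
  end.

(* The coefficient of z ^ 2n in f is also the coefficient of z ^ n in h, so
   that [h] is invertible as a rational matrix function. *)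
Definition htm_mxpol (n : nat) (f : mxpol) : Prop :=
  [/\ (0 < n)%N,
      forall k, (n.*2 < k)%N -> mxcoef f k = 0,
      \det (mxcoef f n.*2) <> 0
    & exists h g : mxpol, f = mxpol_of_parts h g /\
      exists c d : nat -> 'M[R[i]]_q,
        (forall k, (k < n)%N -> posdefmx (c k) /\ posdefmx (d k)) /\
        ratmx_of_mxpol g *m invmx (ratmx_of_mxpol h) = Psi c d 0 n.-1].

End HTM.

(* Main.v *)
Require Import Defs.
From mathcomp Require Import all_boot all_order all_algebra.
From mathcomp Require Import fraction sesquilinear spectral.
From mathcomp Require Import reals complex.

(** The continued fraction Psi_0 is unwound into convergents.  Starting from
    N_n = 0 and D_n = I, put N_k = d_k D_{k+1} + N_{k+1} and
    D_k = z c_k N_k + D_{k+1}; then Psi_k = N_k D_k^-1 ([Psi_convergent]).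
    Three facts about these matrix polynomials give the theorem.

    Positivity ([mxeval_convergent_form]).  Fix a complex z and a vector
    v <> 0, and set x_k = N_k(z) v, y_k = D_k(z) v.  The recursion gives
    x_k^* y_k = z x_k^* c_k x_k + y_{k+1}^* d_k y_{k+1} + x_{k+1}^* y_{k+1},
    so x_0^* y_0 = z a + b with a >= 0 and b >= v^* d_{n-1} v > 0.  A null
    vector of D_0(z) makes the left side vanish, hence Re z < 0.  The same
    identity at z = 1 shows that all N_k and D_k (k < n) are invertible over the
    rational functions, which legitimates every inverse in Psi_0.

    Coprimeness ([convergent_bezout]).  The recursion is a Euclidean algorithm,
    so X N_0 + Y D_0 = I for some matrix polynomials X and Y.  From
    Q P^-1 = N_0 D_0^-1 one gets P = D_0 W and Q = N_0 W with the rational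
    matrix W = D_0^-1 P, and W = X Q + Y P is in fact a polynomial.

    Degree ([convergent_degree], [right_factor_const]).  D_0 has degree n with
    leading coefficient c_0 d_0 ... c_{n-1} d_{n-1}, which is invertible, and P
    is monic of the same degree n.  So W is an invertible constant, det P and
    det D_0 have the same zeros, and positivity finishes the proof. *)

Set Implicit Arguments.
Unset Strict Implicit.
Unset Printing Implicit Defensive.

Import Order.TTheory GRing.Theory Num.Theory.
Local Open Scope ring_scope.
Local Open Scope sesquilinear_scope.
Local Open Scope complex_scope.

Local Notation coefmx k A := (map_mx (coefp k) A).

(** * Degrees of matrix polynomials *)

Section MatrixPolynomialDegree.
Variable F : idomainType.

Lemma coefmxE m n (A : 'M[{poly F}]_(m, n)) k i j : coefmx k A i j = (A i j)`_k.
Proof. by rewrite mxE. Qed.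

Lemma matrix_poly_neq0_lead m n (A : 'M[{poly F}]_(m, n)) : A != 0 ->
  exists2 a, coefmx a A != 0 & forall k, (a < k)%N -> coefmx k A = 0.
Proof.
move=> A0.
have exA : exists k, coefmx k A != 0.
  have /existsP[i /existsP[j Aij]] : [exists i, [exists j, A i j != 0]].
    apply: contraNT A0; rewrite negb_exists => /forallP A_0.
    apply/eqP/matrixP=> i j; rewrite mxE.
    by have := A_0 i; rewrite negb_exists => /forallP/(_ j)/negPn/eqP.
  exists (size (A i j)).-1; apply: contraNneq Aij => /matrixP/(_ i j).
  by rewrite !(coefmxE, mxE) => /eqP; rewrite lead_coef_eq0.
pose s := \max_i \max_j size (A i j).
have bndA k : coefmx k A != 0 -> (k <= s)%N.
  rewrite leqNgt; apply: contraNN => lt_sk; apply/eqP/matrixP=> i j.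
  rewrite !(coefmxE, mxE) nth_default //; apply/ltnW/(leq_trans _ lt_sk).
  rewrite ltnS; apply: (leq_trans _ (leq_bigmax i)).
  exact: (leq_trans _ (leq_bigmax j)).
case: (ex_maxnP exA bndA) => a Aa maxA; exists a => // k lt_ak.
by apply/eqP; apply: contraLR lt_ak => /maxA; rewrite -leqNgt.
Qed.

(** Stated for upper bounds on the degrees: the product on the right may vanish,
    and the lemmas below exploit that it does not when one factor is
    nonsingular. *)
Lemma coefmx_mul_top m n p (A : 'M[{poly F}]_(m, n)) (B : 'M_(n, p)) a b :
    (forall k, (a < k)%N -> coefmx k A = 0) ->
    (forall k, (b < k)%N -> coefmx k B = 0) ->
  coefmx (a + b) (A *m B) = coefmx a A *m coefmx b B.
Proof.
move=> Aa Bb; apply/matrixP=> i j; rewrite !(coefmxE, mxE) coef_sum.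
apply: eq_bigr => k _; rewrite !(coefmxE, mxE) coefM.
have lta : (a < (a + b).+1)%N by rewrite ltnS leq_addr.
rewrite (bigD1 (Ordinal lta)) //= addKn big1 ?addr0 // => s neq_sa.
have [lt_as | lt_sa | eq_sa] := ltngtP a s; last first.
- by case/eqP: neq_sa; apply: val_inj.
- have /matrixP/(_ k j) : coefmx (a + b - s) B = 0.
    by apply: Bb; rewrite -(ltn_add2r s) subnK ?(ltnW (ltn_ord s)) //
      1?addnC ?ltn_add2r // -ltnS ltn_ord.
  by rewrite !(coefmxE, mxE) => ->; rewrite mulr0.
- by have /matrixP/(_ i k) := Aa s lt_as; rewrite !(coefmxE, mxE) => ->; rewrite mul0r.
Qed.

(** A singular A would have a nonzero polynomial row vector v with v A = 0, but
    the top coefficient of v A is that of v times a nonsingular matrix. *)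
Lemma det_lead_neq0 n (A : 'M[{poly F}]_n) a :
    (forall k, (a < k)%N -> coefmx k A = 0) -> \det (coefmx a A) != 0 ->
  \det A != 0.
Proof.
move=> topA; apply: contraNneq => /eqP/det0P[v v0 vA].
have [b vb topv] := matrix_poly_neq0_lead v0.
apply/det0P; exists (coefmx b v) => //.
by rewrite -coefmx_mul_top // vA; apply/matrixP=> i j; rewrite !(coefmxE, mxE) coef0.
Qed.

(** Leading coefficients cannot cancel against a nonsingular one, so the degree
    of A W is the sum of the degrees, leaving none for W. *)
Lemma right_factor_const n (A W : 'M[{poly F}]_n) a :
    (forall k, (a < k)%N -> coefmx k A = 0) -> \det (coefmx a A) != 0 ->
    (forall k, (a < k)%N -> coefmx k (A *m W) = 0) ->
  forall k, (0 < k)%N -> coefmx k W = 0.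
Proof.
move=> topA detA topAW k k_gt0.
have [->|W0] := eqVneq W 0; first by apply/matrixP=> i j; rewrite !(coefmxE, mxE) coef0.
have [w Ww topW] := matrix_poly_neq0_lead W0.
case: w Ww topW => [|w] Ww topW; first exact: topW.
have := coefmx_mul_top topA topW; rewrite topAW ?addnS ?ltnS ?leq_addr //.
(* Over an integral domain the adjugate replaces the inverse. *)
move/esym/(congr1 (mulmx (\adj (coefmx a A)))).
rewrite mulmxA mul_adj_mx mulmx0 mul_scalar_mx => /eqP.
by rewrite scalemx_eq0 (negPf detA) (negPf Ww).
Qed.

End MatrixPolynomialDegree.

Lemma invmx_right_inverse (F : comUnitRingType) n (A B : 'M[F]_n) :
  A *m B = 1%:M -> invmx A = B.
Proof.
by move=> AB; have [uA _] := mulmx1_unit AB; rewrite -[B](mulKmx uA) AB mulmx1.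
Qed.

Lemma invmx_mulV (F : comUnitRingType) n (A B : 'M[F]_n) :
  A \in unitmx -> B \in unitmx -> invmx (A *m invmx B) = B *m invmx A.
Proof.
move=> uA uB; apply: invmx_right_inverse.
by rewrite mulmxA mulmxKV // mulmxV.
Qed.

(** One layer of the fraction, in the form N D^-1 = (z C + D' N^-1)^-1. *)
Lemma invmx_add_scale (F : comUnitRingType) n (z : F) (C N D D' : 'M[F]_n) :
    N \in unitmx -> D \in unitmx -> D = z *: (C *m N) + D' ->
  invmx (z *: C + D' *m invmx N) = N *m invmx D.
Proof.
move=> uN uD DE; apply: invmx_right_inverse.
by rewrite mulmxA mulmxDl -scalemxAl mulmxKV // -DE mulmxV.
Qed.

Lemma det0_colP (F : idomainType) n (A : 'M[F]_n) :
  \det A = 0 -> exists2 v : 'cV_n, v != 0 & A *m v = 0.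
Proof.
rewrite -det_tr => /eqP/det0P[w w0 wA]; exists w^T; first by rewrite trmx_eq0.
by rewrite -[A]trmxK -trmx_mul wA trmx0.
Qed.

(** * Convergents of the matrix continued fraction *)

Section Convergents.
Variables (F : comNzRingType) (q : nat) (c d : nat -> 'M[F]_q).
Local Notation mxpol := 'M[{poly F}]_q.

(** Numerator and denominator of the tail of the fraction that consists of the
    [l] layers with indices [k], ..., [k + l - 1]. The empty tail is 0 / I, which
    makes the innermost layer (z c + d^-1)^-1 an instance of the general step. *)
Fixpoint convergent (k l : nat) : mxpol * mxpol :=
  match l with
  | 0 => (0, 1%:M)
  | l'.+1 =>
    let: (N, D) := convergent k.+1 l' in
    let N' := map_mx polyC (d k) *m D + N in
    (N', 'X *: (map_mx polyC (c k) *m N') + D)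
  end.

Definition cnum k l := (convergent k l).1.
Definition cden k l := (convergent k l).2.

Lemma cnumS k l :
  cnum k l.+1 = map_mx polyC (d k) *m cden k.+1 l + cnum k.+1 l.
Proof. by rewrite /cnum /cden /=; case: convergent. Qed.

Lemma cdenS k l :
  cden k l.+1 = 'X *: (map_mx polyC (c k) *m cnum k l.+1) + cden k.+1 l.
Proof. by rewrite /cnum /cden /=; case: convergent. Qed.

(** Each layer is a pair of division steps with quotients d_k and z c_k, so the
    Bezout relation 0 N + I D = I of the empty tail lifts through all layers. *)
Lemma convergent_bezout k l :
  exists X Y : mxpol, X *m cnum k l + Y *m cden k l = 1%:M.
Proof.
elim: l k => [|l IH] k; first by exists 0, 1%:M; rewrite mul0mx add0r mulmx1.
have [X [Y XY]] := IH k.+1.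
pose Y' := Y - X *m map_mx polyC (d k).
exists (X - 'X *: (Y' *m map_mx polyC (c k))), Y'.
rewrite cdenS mulmxDr mulmxBl -scalemxAl -scalemxAr mulmxA addrA subrK.
by rewrite cnumS mulmxDr /Y' mulmxBl mulmxA addrC addrA subrK addrC.
Qed.

End Convergents.

Section ConvergentDegree.
Variables (F : idomainType) (q : nat) (c d : nat -> 'M[F]_q).

Lemma coefmx_polyC_mul k (A : 'M[F]_q) (B : 'M[{poly F}]_q) :
  coefmx k (map_mx polyC A *m B) = A *m coefmx k B.
Proof.
apply/matrixP=> i j; rewrite !(coefmxE, mxE) coef_sum; apply: eq_bigr => s _.
by rewrite !mxE coefCM.
Qed.

(** Each layer multiplies the leading coefficient of the denominator by
    c_k d_k on the left; the numerator stays one degree lower. *)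
Lemma convergent_degree k l :
    (forall j, (k <= j < k + l)%N -> \det (c j) != 0 /\ \det (d j) != 0) ->
  [/\ forall s, (l <= s)%N -> coefmx s (cnum c d k l) = 0,
      forall s, (l < s)%N -> coefmx s (cden c d k l) = 0
    & \det (coefmx l (cden c d k l)) != 0].
Proof.
elim: l k => [|l IH] k cd0.
  split=> [s _|s s_gt0|]; rewrite /cnum /cden /=.
  - by apply/matrixP=> i j; rewrite !(coefmxE, mxE) coef0.
  - by apply/matrixP=> i j; rewrite !(coefmxE, mxE) coefMn coef1 gtn_eqF // mul0rn.
  - rewrite (_ : coefmx 0 _ = 1%:M) ?det1 ?oner_eq0 //.
    by apply/matrixP=> i j; rewrite !(coefmxE, mxE) coefMn coef1.
have [|topN topD lcD] := IH k.+1.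
  by move=> j /andP[ltkj ltj]; apply: cd0; rewrite ltnW //= addnS -addSn.
have [ck dk] : \det (c k) != 0 /\ \det (d k) != 0.
  by apply: cd0; rewrite leqnn addnS ltnS leq_addr.
have coefN s : (l <= s)%N ->
    coefmx s (cnum c d k l.+1) = d k *m coefmx s (cden c d k.+1 l).
  by move=> les; rewrite cnumS map_mxD coefmx_polyC_mul topN // addr0.
have coefD s : (l <= s)%N ->
    coefmx s.+1 (cden c d k l.+1) = c k *m (d k *m coefmx s (cden c d k.+1 l)).
  move=> les; rewrite -coefN // cdenS map_mxD topD // addr0 -coefmx_polyC_mul.
  by apply/matrixP=> i j; rewrite !(coefmxE, mxE) coefXM.
split=> [s lts|[|s]//|]; first by rewrite coefN 1?ltnW // topD // mulmx0.
- by rewrite ltnS => lts; rewrite coefD 1?ltnW // topD // !mulmx0.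
- by rewrite coefD // !det_mulmx !mulf_neq0.
Qed.

End ConvergentDegree.

(** * Positivity of the convergents *)

Section Positivity.
Variables (R : realType) (q : nat).
Implicit Types (c d : nat -> 'M[R[i]]_q) (v : 'cV[R[i]]_q).

Lemma posdefmx_ge0 (A : 'M[R[i]]_q) (u : 'cV_q) : posdefmx A -> 0 <= (u^t* *m A *m u) 0 0.
Proof.
move=> [_ pA]; have [->|/pA/ltW//] := eqVneq u 0.
by rewrite mulmx0 mxE.
Qed.

Lemma posdefmx_det_neq0 (A : 'M[R[i]]_q) : posdefmx A -> \det A != 0.
Proof.
move=> [_ pA]; apply/eqP=> /det0_colP[v /pA + vA].
by rewrite -mulmxA vA mulmx0 mxE ltxx.
Qed.

(** The source of all positivity: the sesquilinear form pairing the numerator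
    with the denominator telescopes along the layers. Strictness of b comes from
    the innermost layer alone, which contributes v^* d v. *)
Lemma mxeval_convergent_form c d k l (z : R[i]) v :
    (forall j, (k <= j < k + l)%N -> posdefmx (c j) /\ posdefmx (d j)) ->
    v != 0 ->
  exists a b : R[i],
    [/\ 0 <= a, 0 <= b, (0 < l)%N -> 0 < b
      & ((mxeval (cnum c d k l) z *m v)^t* *m (mxeval (cden c d k l) z *m v)) 0 0
        = z * a + b].
Proof.
move=> + v0; elim: l k => [|l IH] k pcd.
  exists 0, 0; split=> //; rewrite /cnum /= /mxeval map_mx0 mul0mx.
  by rewrite trmx0 map_mx0 mul0mx mxE mulr0 addr0.
have [|a [b [a0 b0 bl e]]] := IH k.+1.
  by move=> j /andP[ltkj ltj]; apply: pcd; rewrite ltnW //= addnS -addSn.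
have [pc pd] : posdefmx (c k) /\ posdefmx (d k).
  by apply: pcd; rewrite leqnn addnS ltnS leq_addr.
have evalC (A : 'M[R[i]]_q) : map_mx (horner_eval z) (map_mx polyC A) = A.
  by apply/matrixP=> i j; rewrite !mxE /= /horner_eval hornerC.
set x' := mxeval (cnum c d k.+1 l) z *m v in e.
set y' := mxeval (cden c d k.+1 l) z *m v in e.
set x := mxeval (cnum c d k l.+1) z *m v.
have xE : x = d k *m y' + x'.
  by rewrite /x cnumS /mxeval map_mxD map_mxM evalC mulmxDl -mulmxA.
have yE : mxeval (cden c d k l.+1) z *m v = z *: (c k *m x) + y'.
  rewrite cdenS /mxeval map_mxD map_mxZ map_mxM evalC mulmxDl -scalemxAl -mulmxA.
  by congr (_ *: _ + _); rewrite /= /horner_eval hornerX.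
have d_herm : (d k)^t* = d k.
  by have [/is_hermitianmxP dE _] := pd; rewrite {2}dE expr0 scale1r.
exists ((x^t* *m c k *m x) 0 0 + a), ((y'^t* *m d k *m y') 0 0 + b); split.
- by rewrite addr_ge0 ?posdefmx_ge0.
- by rewrite addr_ge0 ?posdefmx_ge0.
- move=> _; have [l0|/bl] := posnP l; last exact/ltr_wpDl/posdefmx_ge0.
  apply: ltr_wpDr => //; case: pd => _; apply.
  by rewrite /y' l0 /cden /= /mxeval map_mx1 mul1mx.
rewrite yE mulmxDr -scalemxAr mulmxA mxE [X in X + _]mxE.
have -> : x^t* *m y' = y'^t* *m d k *m y' + x'^t* *m y'.
  by rewrite xE linearD /= map_mxD mulmxDl trmx_mul map_mxM d_herm.
by rewrite [X in _ + X]mxE e mulrDr -!addrA; congr (_ + _); rewrite addrCA.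
Qed.

End Positivity.


(** * The fraction as a quotient of its convergents *)

Section Quotient.
Variables (R : realType) (q : nat).
Implicit Types (c d : nat -> 'M[R[i]]_q).

(** A null vector of either factor kills the form z a + b, whose real part is at
    least b > 0 when Re z >= 0 because a and b are real. *)
Lemma convergent_eval_det c d k l (z : R[i]) :
    (forall j, (k <= j < k + l)%N -> posdefmx (c j) /\ posdefmx (d j)) ->
    (0 < l)%N -> 0 <= complex.Re z ->
  \det (mxeval (cnum c d k l) z) != 0 /\ \det (mxeval (cden c d k l) z) != 0.
Proof.
move=> pcd l0 z_ge0.
have nonroot (v : 'cV_q) : v != 0 ->
    ((mxeval (cnum c d k l) z *m v)^t* *m (mxeval (cden c d k l) z *m v)) 0 0 != 0.
  move=> v0; have [a [b [a0 b0 /(_ l0) b_gt0 ->]]] := mxeval_convergent_form z pcd v0.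
  case: z a b a0 b0 b_gt0 z_ge0 => zr zi [ar ai] [br bi] /=.
  rewrite !lecE !ltcE /= => /andP[/eqP-> a0] _ /andP[/eqP-> b0] z0.
  rewrite eq_complex /= negb_and mulr0 subr0 gt_eqF //.
  by apply: ltr_wpDl => //; apply: mulr_ge0.
by split; apply/eqP=> /det0_colP[v /nonroot + vA];
  rewrite vA ?mulmx0 ?trmx0 ?map_mx0 ?mul0mx mxE eqxx.
Qed.

Lemma ratmx_unitmx (A : 'M[{poly R[i]}]_q) :
  (ratmx_of_mxpol A \in unitmx) = (\det A != 0).
Proof. by rewrite unitmxE unitfE det_map_mx tofrac_eq0. Qed.

Lemma ratmxM (A B : 'M[{poly R[i]}]_q) :
  ratmx_of_mxpol (A *m B) = ratmx_of_mxpol A *m ratmx_of_mxpol B.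
Proof. exact: map_mxM. Qed.

Lemma ratmxD (A B : 'M[{poly R[i]}]_q) :
  ratmx_of_mxpol (A + B) = ratmx_of_mxpol A + ratmx_of_mxpol B.
Proof. exact: map_mxD. Qed.

Lemma ratmx_inj : injective (@ratmx_of_mxpol R q).
Proof.
move=> A B /matrixP AB; apply/matrixP=> i j; have := AB i j.
by rewrite !mxE => /eqP; rewrite tofrac_eq => /eqP.
Qed.

Lemma ratmx_unitmx_eval (A : 'M[{poly R[i]}]_q) z :
  \det (mxeval A z) != 0 -> ratmx_of_mxpol A \in unitmx.
Proof.
rewrite ratmx_unitmx det_map_mx; apply: contraNneq => ->.
by rewrite /= /horner_eval horner0.
Qed.

Lemma ratmx_cnumS c d k l :
  ratmx_of_mxpol (cnum c d k l.+1) =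
    ratmx_of_const (d k) *m ratmx_of_mxpol (cden c d k.+1 l)
    + ratmx_of_mxpol (cnum c d k.+1 l).
Proof. by rewrite cnumS /ratmx_of_mxpol map_mxD map_mxM. Qed.

Lemma ratmx_cdenS c d k l :
  ratmx_of_mxpol (cden c d k l.+1) =
    Defs.ratz R *: (ratmx_of_const (c k) *m ratmx_of_mxpol (cnum c d k l.+1))
    + ratmx_of_mxpol (cden c d k.+1 l).
Proof. by rewrite cdenS /ratmx_of_mxpol map_mxD map_mxZ map_mxM. Qed.

(** Evaluation at z = 1 supplies the invertibility that each layer needs. *)
Lemma Psi_convergent c d k m :
    (forall j, (k <= j < k + m.+1)%N -> posdefmx (c j) /\ posdefmx (d j)) ->
  Psi c d k m = ratmx_of_mxpol (cnum c d k m.+1)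
                *m invmx (ratmx_of_mxpol (cden c d k m.+1)).
Proof.
elim: m k => [|m IH] k pcd;
  have [/ratmx_unitmx_eval uN /ratmx_unitmx_eval uD] :=
    convergent_eval_det pcd (ltn0Sn _) (ler01 : 0 <= complex.Re 1);
  rewrite /= -(invmx_add_scale uN uD (ratmx_cdenS _ _ _ _)); congr (invmx (_ + _)).
  rewrite ratmx_cnumS /cnum /cden /= [ratmx_of_mxpol 1%:M]map_mx1.
  rewrite [ratmx_of_mxpol 0]map_mx0 mulmx1 addr0 mul1mx.
  by rewrite /ratmx_of_const /ratmx_of_mxpol -!map_mx_comp map_invmx.
have pcd' j : (k.+1 <= j < k.+1 + m.+1)%N -> posdefmx (c j) /\ posdefmx (d j).
  by move=> /andP[ltkj ltj]; apply: pcd; rewrite ltnW //= addnS -addSn.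
have [_ /ratmx_unitmx_eval uD'] :=
  convergent_eval_det pcd' (ltn0Sn _) (ler01 : 0 <= complex.Re 1).
rewrite (IH _ pcd') -[ratmx_of_const (d k)](mulmxK uD') -mulmxDl -ratmx_cnumS.
by rewrite (invmx_mulV uN uD').
Qed.

(** The two parts occupy the even and the odd coefficients. *)
Lemma mxpol_of_parts_inj (h g h' g' : 'M[{poly R[i]}]_q) :
  mxpol_of_parts h g = mxpol_of_parts h' g' -> h = h' /\ g = g'.
Proof.
move=> /matrixP e; split; apply/matrixP=> i j; apply/polyP=> k.
  have := congr1 (fun p : {poly _} => p`_k.*2) (e i j).
  rewrite !mxE !coefD !coefXM !coef_comp_poly_Xn // -muln2 dvdn_mull // mulnK //.
  case: k => [|k]; first by rewrite !addr0.
  by rewrite mulSn /= dvdn2 /= muln2 odd_double /= !addr0.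
have := congr1 (fun p : {poly _} => p`_k.*2.+1) (e i j).
rewrite !mxE !coefD !coefXM !coef_comp_poly_Xn //= !dvdn2 /= odd_double /=.
by rewrite !add0r divn2 doubleK.
Qed.

End Quotient.

Theorem theorem5p1 (R : realType) (q n : nat) (hq : (1 <= q)%N) (hn : (1 <= n)%N)
    (P : 'M[{poly R[i]}]_q) (degP : has_mxdegree P n)
    (monicP : mxcoef P n = 1%:M)
    (htm : exists Q : 'M[{poly R[i]}]_q,
        has_mxdegree Q n.-1 /\ htm_mxpol n (mxpol_of_parts P Q)) :
  hurwitz_mxpol P.
Proof.
case: htm => Q [_ [_ _ _ [h [g [/mxpol_of_parts_inj[<- <-] [c [d [pcd QP]]]]]]]].
have {}pcd j : (0 <= j < 0 + n)%N -> posdefmx (c j) /\ posdefmx (d j) by exact: pcd.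
have [_ topP] := degP.
have lcP : coefmx n P = 1%:M := monicP.
have uP : ratmx_of_mxpol P \in unitmx.
  by rewrite ratmx_unitmx; apply: (det_lead_neq0 topP); rewrite lcP det1 oner_eq0.
pose N := cnum c d 0 n; pose D := cden c d 0 n.
have [_ topD lcD] : [/\ forall s, (n <= s)%N -> coefmx s N = 0,
    forall s, (n < s)%N -> coefmx s D = 0 & \det (coefmx n D) != 0].
  by apply: convergent_degree => j /pcd[]; split; apply: posdefmx_det_neq0.
have uD : ratmx_of_mxpol D \in unitmx.
  by rewrite ratmx_unitmx; apply: (det_lead_neq0 topD lcD).
(* W = D^-1 P is a rational matrix; the Bezout relation makes it polynomial. *)
have [W PE] : exists W, P = D *m W.
  have [X [Y XY]] := convergent_bezout c d 0 n.
  exists (X *m Q + Y *m P); apply: ratmx_inj.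
  have [w Pw Qw] : exists2 w, ratmx_of_mxpol P = ratmx_of_mxpol D *m w
      & ratmx_of_mxpol Q = ratmx_of_mxpol N *m w.
    exists (invmx (ratmx_of_mxpol D) *m ratmx_of_mxpol P).
      by rewrite (mulKVmx uD).
    have NDE : ratmx_of_mxpol N *m invmx (ratmx_of_mxpol D) = Psi c d 0 n.-1.
      by rewrite Psi_convergent prednK.
    by rewrite mulmxA NDE -QP (mulmxKV uP).
  rewrite ratmxM ratmxD (ratmxM X) (ratmxM Y) Pw Qw.
  rewrite (mulmxA (ratmx_of_mxpol X)) (mulmxA (ratmx_of_mxpol Y)) -mulmxDl.
  by rewrite -(ratmxM X) -(ratmxM Y) -ratmxD XY [ratmx_of_mxpol 1%:M]map_mx1 mul1mx.
have W0 : forall k, (0 < k)%N -> coefmx k W = 0.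
  by apply: (right_factor_const topD lcD); rewrite -PE.
have evalW z : mxeval W z = coefmx 0 W.
  apply/matrixP=> i j; rewrite coefmxE mxE /= /horner_eval.
  have sW : (size (W i j) <= 1)%N.
    by apply/leq_sizeP=> k /W0/matrixP/(_ i j); rewrite coefmxE mxE.
  by rewrite (size1_polyC sW) hornerC coefC.
have detW : \det (coefmx 0 W) != 0.
  have : \det (coefmx n D *m coefmx 0 W) = 1.
    by rewrite -coefmx_mul_top // addn0 -PE lcP det1.
  by rewrite det_mulmx => e; apply: contra_eq_neq e => ->; rewrite mulr0 eq_sym oner_eq0.
move=> z; rewrite PE /mxeval map_mxM -!/(mxeval _ _) det_mulmx evalW => /eqP.
rewrite mulf_eq0 (negPf detW) orbF => /eqP Dz; rewrite ltNge; apply/negP=> z_ge0.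
by have [_] := convergent_eval_det pcd hn z_ge0; rewrite Dz eqxx.
Qed.
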